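(* Let $\tau\in\mathbb{R}$ with $\tau\neq 0$. There is no entire spacelike graph with zero mean curvature in the Lorentzian Heisenberg space $\mathrm{Nil}^3_1(\tau)$; that is, there is no function $f:\mathbb{R}^2\to\mathbb{R}$ of class $C^2$ whose graph $z=f(x,y)$ is a spacelike surface of zero mean curvature in $\mathrm{Nil}^3_1(\tau)$.
   Context: The Lorentzian Heisenberg space $\mathrm{Nil}^3_1(\tau)=\mathbb{L}^3(0,\tau)$ is $\mathbb{R}^3$ endowed with the Lorentzian metric $dx^2+dy^2-\left[\tau(y\,dx-x\,dy)+dz\right]^2$. A surface is spacelike if its induced metric is positive definite. A graph $z=f(x,y)$ is entire if $f$ is defined on all of $\mathbb{R}^2$. With $(\alpha,\beta)=(f_x+\tau y,\ f_y-\tau x)$, the graph is spacelike if and only if $1-\alpha^2-\beta^2>0$, and a spacelike graph has zero mean curvature if and only if $\frac{\partial}{\partial x}\left(\frac{\alpha}{\sqrt{1-\alpha^2-\beta^2}}\right)+\frac{\partial}{\partial y}\left(\frac{\beta}{\sqrt{1-\alpha^2-\beta^2}}\right)=0$. *)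

(* Defs.v *)
From mathcomp Require Import all_boot all_order all_algebra.
From mathcomp Require Import all_classical all_reals all_analysis.

Set Implicit Arguments.
Unset Strict Implicit.
Unset Printing Implicit Defensive.

Import Order.TTheory GRing.Theory Num.Theory.
Import numFieldNormedType.Exports.
Local Open Scope classical_set_scope.
Local Open Scope ring_scope.

Section Calculus.
Variables (R : realType) (n : nat).
Implicit Types F : 'rV[R]_n -> R.

Definition partial (i : 'I_n) F (p : 'rV[R]_n) : R := 'D_(delta_mx 0 i) F p.

Definition class_C1 F : Prop := forall i,
  (forall p, derivable F p (delta_mx 0 i)) /\ continuous (partial i F).

Definition class_C2 F : Prop :=
  class_C1 F /\ forall i, class_C1 (partial i F).

End Calculus.

(* Pseudo-Riemannian geometry of parametrized surfaces [X] in R^3 endowed with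
   the metric whose Gram matrix at [p], in the coordinate frame, is [g p].
   Tangent vectors are the row vectors of their coordinates. *)
Section Surfaces.
Variables (R : realType) (g : 'rV[R]_3 -> 'M[R]_3).
Implicit Types (p v w : 'rV[R]_3) (u : 'rV[R]_2) (X : 'rV[R]_2 -> 'rV[R]_3).

(* Gamma^k_ij of the Levi-Civita connection of [g]. *)
Definition christoffel p (k i j : 'I_3) : R :=
  2^-1 * \sum_(l < 3) invmx (g p) k l *
    (partial i (fun q => g q j l) p + partial j (fun q => g q i l) p
     - partial l (fun q => g q i j) p).

(* Row [a] is the coordinate tangent vector X_a = dX/du_a. *)
Definition tangents X u : 'M[R]_(2, 3) :=
  \matrix_(a, k) partial a (fun t => X t 0 k) u.

Definition induced_metric X u : 'M[R]_2 :=
  tangents X u *m g (X u) *m (tangents X u)^T.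

Definition spacelike X : Prop := forall u (v : 'rV[R]_2),
  v != 0 -> 0 < (v *m induced_metric X u *m v^T) 0 0.

(* The covariant derivative of the field X_b along X_a. *)
Definition covariant_derivative X u (a b : 'I_2) : 'rV[R]_3 :=
  \row_k (partial a (fun t => tangents X t b k) u +
          \sum_(i < 3) \sum_(j < 3)
             christoffel (X u) k i j * tangents X u a i * tangents X u b j).

(* The g-orthogonal projection of [v] onto the normal space of [X] at [u],
   namely v - sum_(a, b) h^{ab} g(v, X_a) X_b, with h the induced metric. *)
Definition normal_part X u v : 'rV[R]_3 :=
  v - v *m g (X u) *m (tangents X u)^T
        *m invmx (induced_metric X u) *m tangents X u.

Definition second_fundamental_form X u (a b : 'I_2) : 'rV[R]_3 :=
  normal_part X u (covariant_derivative X u a b).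

(* Half the trace of the second fundamental form; it is H N (up to sign) for
   either unit normal N, so it vanishes exactly when the mean curvature H
   does. *)
Definition mean_curvature_vector X u : 'rV[R]_3 :=
  2^-1 *: \sum_(a < 2) \sum_(b < 2)
    invmx (induced_metric X u) a b *: second_fundamental_form X u a b.

Definition zero_mean_curvature X : Prop :=
  forall u, mean_curvature_vector X u = 0.

End Surfaces.

Section Heisenberg.
Variables (R : realType) (tau : R).

(* The 1-form tau (y dx - x dy) + dz. *)
Definition heisenberg_form (p : 'rV[R]_3) : 'rV[R]_3 :=
  \row_(i < 3) [:: tau * p 0 1; - (tau * p 0 0); 1]`_i.

(* dx^2 + dy^2 - (tau (y dx - x dy) + dz)^2 *)
Definition heisenberg_metric (p : 'rV[R]_3) : 'M[R]_3 :=
  pid_mx 2 - (heisenberg_form p)^T *m heisenberg_form p.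

End Heisenberg.

Definition graph_of (R : realType) (f : 'rV[R]_2 -> R) (u : 'rV[R]_2) :
    'rV[R]_3 :=
  \row_(k < 3) [:: u 0 0; u 0 1; f u]`_k.

(* Main.v *)
Require Import Defs.
From mathcomp Require Import all_boot all_order all_algebra.
From mathcomp Require Import all_classical all_reals all_analysis.
From mathcomp Require Import ring lra.
Import Order.TTheory GRing.Theory Num.Theory.
Import numFieldNormedType.Exports.
Local Open Scope ring_scope.

(** The obstruction is the curl of the field
    (alpha, beta) = (f_x + tau y, f_y - tau x): the pull-back to the plane of
    the 1-form tau (y dx - x dy) + dz is alpha dx + beta dy, whose exterior
    derivative is - 2 tau dx dy, because the part df is closed.  Its
    circulation around an axis-parallel square of side L therefore has
    absolute value 2 |tau| L^2.  On the other hand, a spacelike graph has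
    |alpha| < 1 and |beta| < 1 (the coordinate tangent vectors of the graph
    have squared lengths 1 - alpha^2 and 1 - beta^2, see
    [spacelike_graph_slopes]), so the absolute value of the circulation is less
    than the perimeter 4 L.  An entire graph allows L = 2 / |tau|, for which
    the two quantities are equal: contradiction.

    This argument is dual to the flux argument of Heinz, Chern and Flanders
    against entire graphs of constant nonzero mean curvature in Euclidean space:
    (alpha, beta) rotated by a right angle is a field of length less than 1
    with constant divergence 2 tau.

    The circulation along an edge is the increment of f plus a constant times
    L, since the 1-form tau (y dx - x dy) has a constant coefficient along each
    axis-parallel line; hence no integral is needed, and the mean value theorem
    on each edge suffices ([edge_increment_lt]). *)

(** This reduces statements about partial derivatives to the calculus of one
    real variable, in particular to the mean value theorem. *)
Lemma is_derive_along_line (R : realType) (n : nat) (F : 'rV[R]_n -> R)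
    (p v : 'rV[R]_n) (t d : R) :
  is_derive t (1 : R) (fun s => F (p + s *: v)) d <->
  is_derive (p + t *: v) v F d.
Proof.
(* Both sides are about the same difference quotient. *)
have quotientE : (fun h : R => h^-1 *: (((fun s => F (p + s *: v)) \o shift t)
      (h *: (1 : R)) - F (p + t *: v))) =
    (fun h => h^-1 *: ((F \o shift (p + t *: v)) (h *: v) - F (p + t *: v))).
  apply/funext => h /=; congr (_ *: (F _ - _)).
  by rewrite [h *: 1]mulr1 scalerDl addrCA.
by split=> -[]; rewrite /derivable /derive ?quotientE => dF Fd; split;
  rewrite /derivable /derive ?quotientE.
Qed.

Lemma partial_coord (R : realType) (n : nat) (i j : 'I_n) (u : 'rV[R]_n) :
  partial i (fun q => q 0 j) u = (j == i)%:R.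
Proof.
suff [_] : is_derive (u + 0 *: delta_mx 0 i) (delta_mx 0 i)
    (fun q : 'rV[R]_n => q 0 j) (j == i)%:R by rewrite scale0r addr0.
apply/is_derive_along_line.
rewrite (_ : (fun _ => _) = (fun s : R => u 0 j + s * (j == i)%:R)); last first.
  by apply/funext => s; rewrite !mxE eqxx.
by apply: is_derive_eq; rewrite scaler0 !add0r mul1r [_ *: 1]mulr1.
Qed.

(** The deviation of the increment from [c * L] is the circulation along an edge
    of length [L] of dF minus a form with constant coefficient [c]. *)
Lemma edge_increment_lt (R : realType) (n : nat) (F : 'rV[R]_n -> R)
    (p : 'rV[R]_n) (i : 'I_n) (c L : R) :
    0 < L ->
    (forall q, derivable F q (delta_mx 0 i)) ->
    (forall t, `|partial i F (p + t *: delta_mx 0 i) - c| < 1) ->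
  `|F (p + L *: delta_mx 0 i) - F p - c * L| < L.
Proof.
move=> L_gt0 dF slope_lt.
have dline t : is_derive t (1 : R) (fun s => F (p + s *: delta_mx 0 i))
    (partial i F (p + t *: delta_mx 0 i)).
  by apply/is_derive_along_line/derivableP.
have [|t _] := MVT L_gt0 (fun t _ => dline t).
  apply: derivable_within_continuous => t _.
  exact: (@ex_derive _ _ _ _ _ _ _ (dline t)).
rewrite scale0r addr0 subr0 => ->.
by rewrite -mulrBl normrM (gtr0_norm L_gt0) gtr_pMl.
Qed.

Lemma heisenberg_metric_sqr (R : realType) (tau : R) (p w : 'rV[R]_3) :
  (w *m heisenberg_metric tau p *m w^T) 0 0 =
  w 0 0 ^+ 2 + w 0 1 ^+ 2 - (w *m (heisenberg_form tau p)^T) 0 0 ^+ 2.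
Proof.
set form := heisenberg_form tau p.
have formE : w *m (form^T *m form) *m w^T = w *m form^T *m (w *m form^T)^T.
  by rewrite trmx_mul trmxK !mulmxA.
rewrite mulmxBr mulmxBl formE mxE [X in _ + X]mxE; congr (_ - _); last first.
  by rewrite mxE big_ord1 [X in _ * X]mxE.
rewrite -mulmxA mxE !big_ord_recl big_ord0 !mxE !big_ord_recl !big_ord0 !mxE /=.
rewrite (_ : lift ord0 ord0 = 1); last exact: val_inj.
by ring.
Qed.

(** The coordinate tangent vectors of the graph are (1, 0, f_x) and
    (0, 1, f_y), so their squared lengths are 1 minus the squares of the slopes
    alpha and beta. *)
Lemma spacelike_graph_slopes (R : realType) (tau : R) (f : 'rV[R]_2 -> R) :
    spacelike (heisenberg_metric tau) (graph_of f) -> forall u,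
  `|partial 0 f u + tau * u 0 1| < 1 /\ `|partial 1 f u - tau * u 0 0| < 1.
Proof.
move=> spacelike_f u.
have coordE (k : 'I_3) (i : 'I_2) : tangents (graph_of f) u i k =
    [:: (i == 0)%:R; (i == 1)%:R; partial i f u]`_k.
  rewrite mxE.
  transitivity (partial i (fun t : 'rV[R]_2 => [:: t 0 0; t 0 1; f t]`_k) u).
    by congr (partial _ _ _); apply/funext => t; rewrite mxE.
  by case: k => -[|[|[|]]] //= _; rewrite partial_coord eq_sym.
have slope_lt (i : 'I_2) :
    `|partial i f u + tau * ((i == 0)%:R * u 0 1 - (i == 1)%:R * u 0 0)| < 1.
  have e_neq0 : delta_mx 0 i != 0 :> 'rV[R]_2.
    by apply/eqP => /rowP/(_ i)/eqP; rewrite !mxE !eqxx oner_eq0.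
  have := spacelike_f u _ e_neq0.
  rewrite /induced_metric !mulmxA -mulmxA -trmx_mul -rowE.
  have rowE k : row i (tangents (graph_of f) u) 0 k =
      [:: (i == 0)%:R; (i == 1)%:R; partial i f u]`_k by rewrite mxE coordE.
  move: (row i _) rowE => w wE.
  rewrite heisenberg_metric_sqr [X in _ - X ^+ 2]mxE.
  rewrite !big_ord_recl big_ord0 !wE !mxE /=.
  have -> : (i == 0)%:R ^+ 2 + (i == 1)%:R ^+ 2 = 1 :> R.
    by case: i {e_neq0 wE} => -[|[|]] //= ?;
      rewrite expr0n expr1n ?addr0 ?add0r.
  rewrite -(@expr_lt1 _ 2) // real_normK ?num_real // -subr_gt0.
  by congr (0 < _ - _ ^+ 2); ring.
by have := slope_lt 0; have := slope_lt 1;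
  rewrite /= !mul1r !mul0r subr0 sub0r mulrN.
Qed.

Theorem theorem1p15 (R : realType) (tau : R) (tau_neq0 : tau != 0) :
  ~ exists f : 'rV[R]_2 -> R,
      [/\ class_C2 f,
          spacelike (heisenberg_metric tau) (graph_of f) &
          zero_mean_curvature (heisenberg_metric tau) (graph_of f)].
Proof.
move=> [f [[C1f _] /spacelike_graph_slopes slopes _]].
have df i q : derivable f q (delta_mx 0 i) by case: (C1f i).
have [L L_gt0 tauL] : exists2 L : R, 0 < L & `|tau| * L = 2.
  exists (2 / `|tau|); first by rewrite divr_gt0 ?normr_gt0.
  by rewrite mulrC divfK ?normr_eq0.
pose e (i : 'I_2) : 'rV[R]_2 := delta_mx 0 i.
have bottom : `|f (0 + L *: e 0) - f 0 - 0 * L| < L.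
  apply: edge_increment_lt => // t; have [+ _] := slopes (0 + t *: e 0).
  by rewrite !mxE /= !mulr0 addr0 mulr0 subr0 addr0.
have left : `|f (0 + L *: e 1) - f 0 - 0 * L| < L.
  apply: edge_increment_lt => // t; have [_] := slopes (0 + t *: e 1).
  by rewrite !mxE /= !mulr0 addr0 mulr0.
have top : `|f (L *: e 1 + L *: e 0) - f (L *: e 1) - (- (tau * L)) * L| < L.
  apply: edge_increment_lt => // t; have [+ _] := slopes (L *: e 1 + t *: e 0).
  by rewrite !mxE /= !mulr0 !mulr1 addr0 opprK.
have right : `|f (L *: e 0 + L *: e 1) - f (L *: e 0) - tau * L * L| < L.
  apply: edge_increment_lt => // t; have [_] := slopes (L *: e 0 + t *: e 1).
  by rewrite !mxE /= !mulr0 !mulr1 addr0.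
have circulation : `|2 * tau * L ^+ 2| = 4 * L.
  rewrite expr2 !normrM normr_nat (gtr0_norm L_gt0) -[2 * _ * _]mulrA.
  by rewrite [`|tau| * _]mulrA tauL; ring.
move: bottom left top right; rewrite !add0r [L *: e 1 + _]addrC !mul0r !subr0.
rewrite !ltr_norml => /andP[? ?] /andP[? ?] /andP[? ?] /andP[? ?].
(* Around the square the increments of f cancel, and the remaining constants
   add up to the circulation. *)
suff : `|2 * tau * L ^+ 2| < 4 * L by rewrite circulation ltxx.
by rewrite ltr_norml; apply/andP; split; lra.
Qed.
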